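(* Let $z\in\mathbb{C}\setminus(-\infty,0]$ and $w=\sqrt{-2\mathrm{i}z}$ (principal square root). Then, for real $\theta$, $$\mathrm{erf}\big(w\cos(\theta/2)\big)=2\,e^{-\frac12 w^2\cos\theta}\sum_{m=0}^\infty I_{m+\frac12}(w^2/2)\,\cos\big((m+\tfrac12)\theta\big).$$
   Context: $\mathrm{erf}(x)=\frac{2}{\sqrt\pi}\int_0^x e^{-t^2}\,\mathrm{d}t$ is the error function. $I_\nu$ is the modified Bessel function of the first kind, $I_\nu(x)=(x/2)^\nu\sum_{k\ge0}\frac{(x/2)^{2k}}{k!\,\Gamma(\nu+k+1)}$, with the principal branch of the power $(x/2)^\nu$. *)

(* Defs.v *)
From Stdlib Require Import Reals Factorial.
From Coquelicot Require Import Coquelicot.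

Open Scope C_scope.

Definition Cexp (z : C) : C :=
  (exp (Re z) * cos (Im z), exp (Re z) * sin (Im z))%R.

(* Principal argument, with values in (-PI, PI]: a negative real has
   argument PI.  The value at 0 is irrelevant. *)
Definition Carg (z : C) : R :=
  if Rle_dec 0 (Im z) then acos (Re z / Cmod z) else (- acos (Re z / Cmod z))%R.

Definition Clog (z : C) : C := (ln (Cmod z), Carg z).

(* Principal branch of z^a for a real exponent; the value at z = 0 is set
   separately because ln 0 is a junk value. *)
Definition Cpower (z : C) (a : R) : C :=
  if Ceq_dec z 0 then (if Req_EM_T a 0 then 1 else 0)
  else Cexp (RtoC a * Clog z).

Definition Csqrt (z : C) : C := Cpower z (1 / 2).

(* Integral of f along the straight segment from a to b. *)
Definition CInt (f : C -> C) (a b : C) : C :=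
  (b - a) *
  RInt (V := C_R_CompleteNormedModule) (fun s : R => f (a + RtoC s * (b - a))) 0 1.

(* The integrand is entire, so the segment may replace any path from 0 to x. *)
Definition erf (x : C) : C :=
  RtoC (2 / sqrt PI) * CInt (fun t => Cexp (- (t * t))) 0 x.

(* Sum of a complex series; like Coquelicot's Series, it is meaningful only
   when the series converges. *)
Definition CSeries (a : nat -> C) : C :=
  (Series (fun n => Re (a n)), Series (fun n => Im (a n))).

(* Euler's integral, which represents Gamma for x > 0. *)
Definition Gamma (x : R) : R :=
  RInt_gen (fun t => Rpower t (x - 1) * exp (- t))%R
    (at_right 0) (Rbar_locally p_infty).

(* Modified Bessel function of the first kind, for real order nu > -1, so that
   Gamma is only evaluated at positive arguments. *)
Definition BesselI (nu : R) (x : C) : C :=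
  Cpower (x / 2) nu *
  CSeries (fun k : nat =>
    (x / 2) ^ (2 * k) / RtoC (INR (fact k) * Gamma (nu + INR k + 1))).

(* Main.v *)
Require Import Defs.
From Stdlib Require Import Reals Factorial Lra Lia.
From Coquelicot Require Import Coquelicot.
Open Scope C_scope.

(** Put p = w/2 and q = p^2 = w^2/4.  Since w is a principal square root,
    I_(m+1/2)(2q) = p q^m H_(m+1), where
    H_n = sum_k q^(2k) / (k! Gamma(n+k+1/2)).
    Let S_M be the sum over m < M of the terms p q^m H_(m+1) cos((m+1/2) theta).
    The recurrence (n+1/2) H_(n+1) = H_n - q^2 H_(n+2) makes
    2q sin(theta) S_M + dS_M/dtheta telescope; because
    H_0 - q H_1 = exp(-2q)/sqrt(pi), its lower end is exactly what comes from
    differentiating erf.  Hence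
    D_M(theta) = 2 exp(-2q cos theta) S_M - erf(w cos(theta/2)) vanishes at
    theta = pi and has a derivative consisting of the upper boundary terms
    q^M H_M and q^(M+1) H_(M+1) only.  These tend to 0, so D_M tends to 0 by the
    mean value inequality. *)

(** * The Gaussian integral and Gamma at half-integers *)

Open Scope R_scope.

(** Partial sums are used because their theta-derivatives are exact finite identities: no
    interchange of sum and derivative is needed, and convergence and the value of the sum come out
    of a single estimate. Differentiation is only ever along a real parameter, so complex functions
    are treated through their real and imaginary parts. Two matters outside this computation need
    care. One is a constant: Gamma is given by Euler's integral, and its values at half-integers
    must produce the same sqrt(pi) that normalises erf, hence the Gaussian integral. The other is a
    sign: the principal power (w^2/4)^(m+1/2) must contain w/2 and not -w/2, which rests on the
    principal root commuting with positive scaling. H_0 belongs to the order -1/2, one below the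
    orders in the series; it is there so that the recurrence can close the telescoping sum at its
    lower end. *)

Definition gauss (x : R) : R := RInt (fun t => exp (- (t * t))) 0 x.

Lemma is_derive_gauss (x : R) : is_derive gauss x (exp (- (x * x))).
Proof.
  apply (is_derive_RInt (fun t => exp (- (t * t))) gauss 0 x).
  - apply filter_forall. intros b.
    apply (RInt_correct (V := R_CompleteNormedModule)).
    apply (ex_RInt_continuous (V := R_CompleteNormedModule)).
    intros z _. apply (ex_derive_continuous (V := R_NormedModule)). auto_derive. exact I.
  - apply (ex_derive_continuous (V := R_NormedModule)). auto_derive. exact I.
Qed.

Lemma continuous_gauss (x : R) : continuous gauss x.
Proof.
  apply (ex_derive_continuous (V := R_NormedModule)).
  eexists. apply is_derive_gauss.
Qed.

Lemma gauss_0 : gauss 0 = 0.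
Proof. exact (RInt_point 0 _). Qed.

(** A parametric integral that replaces polar coordinates: at 0 it is the arctangent integral with
    value pi/4, and it vanishes at infinity. *)
Definition gauss_aux (x : R) : R :=
  RInt (fun t => exp (- (x * x * (1 + t * t))) / (1 + t * t)) 0 1.

(** Differentiating under the integral cancels the denominator; the factor x that appears is the
    Jacobian of the substitution u = x t, which turns what remains into [gauss x]. *)
Lemma is_derive_gauss_aux (x : R) :
  is_derive gauss_aux x (- 2 * exp (- (x * x)) * gauss x).
Proof.
  assert (Hd : forall t y, Derive (fun u => exp (- (u * u * (1 + t * t))) / (1 + t * t)) y
                      = - 2 * y * exp (- (y * y * (1 + t * t)))).
  { intros t y. apply is_derive_unique. auto_derive. exact I.
    field. nra. }
  assert (Hc : forall y t, continuous (fun t => exp (- (y * y * (1 + t * t))) / (1 + t * t)) t).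
  { intros y t. apply (ex_derive_continuous (V := R_NormedModule)). auto_derive.
    nra. }
  evar_last.
  - apply (is_derive_RInt_param
      (fun x t => exp (- (x * x * (1 + t * t))) / (1 + t * t)) 0 1 x).
    + apply filter_forall. intros y t _. auto_derive. exact I.
    + intros t _.
      apply (continuity_2d_pt_ext (fun u v => (- 2 * u) * exp (- (u * u * (1 + v * v))))).
      { intros u v. symmetry. apply Hd. }
      apply continuity_2d_pt_mult.
      * apply continuity_2d_pt_mult.
        apply continuity_2d_pt_const. apply continuity_2d_pt_id1.
      * apply (continuity_1d_2d_pt_comp exp (fun u v => - (u * u * (1 + v * v)))).
        -- apply derivable_continuous_pt, derivable_pt_exp.
        -- apply continuity_2d_pt_opp, continuity_2d_pt_mult.
           ++ apply continuity_2d_pt_mult; apply continuity_2d_pt_id1.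
           ++ apply continuity_2d_pt_plus. apply continuity_2d_pt_const.
              apply continuity_2d_pt_mult; apply continuity_2d_pt_id2.
    + apply filter_forall. intros y.
      apply (ex_RInt_continuous (V := R_CompleteNormedModule)). intros z _. apply Hc.
  - cbv beta.
    assert (Hg : is_RInt (fun y => scal x (exp (- ((x * y + 0) * (x * y + 0))))) 0 1 (gauss x)).
    { apply (is_RInt_comp_lin (V := R_NormedModule) (fun t => exp (- (t * t))) x 0 0 1).
      rewrite Rmult_0_r, Rmult_1_r, !Rplus_0_r.
      apply (RInt_correct (V := R_CompleteNormedModule)).
      apply (ex_RInt_continuous (V := R_CompleteNormedModule)).
      intros z _. apply (ex_derive_continuous (V := R_NormedModule)). auto_derive. exact I. }
    apply (is_RInt_scal _ _ _ (- 2 * exp (- (x * x)))) in Hg.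
    apply is_RInt_unique.
    eapply is_RInt_ext; [|exact Hg].
    intros t _. rewrite Hd. unfold scal; simpl; unfold mult; simpl.
    replace (- (x * x * (1 + t * t))) with (- (x * x) + - ((x * t + 0) * (x * t + 0))) by ring.
    rewrite exp_plus. ring.
Qed.

(* Differentiating in [x] turns the auxiliary integral into [- (gauss^2)']. *)
Lemma gauss_sqr (x : R) : gauss x * gauss x + gauss_aux x = PI / 4.
Proof.
  assert (H0 : gauss 0 * gauss 0 + gauss_aux 0 = PI / 4).
  { rewrite gauss_0. unfold gauss_aux.
    rewrite Rmult_0_l, Rplus_0_l.
    apply is_RInt_unique.
    evar_last.
    - apply (is_RInt_ext (fun t => / (1 + t ^ 2))).
      { intros t _. replace (- (0 * (1 + t * t))) with 0 by ring. rewrite exp_0. change (/ (1 + t ^ 2) = 1 / (1 + t * t)). field. nra. }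
      apply (is_RInt_derive (V := R_CompleteNormedModule) atan (fun t => / (1 + t ^ 2))).
      + intros t _. evar_last. apply is_derive_atan. unfold Rsqr. f_equal. ring.
      + intros t _. apply (ex_derive_continuous (V := R_NormedModule)). auto_derive. nra.
    - rewrite atan_0, atan_1. unfold minus, plus, opp; simpl. ring. }
  rewrite <- H0.
  (* Zero derivative gives constancy through the mean value inequality with bound 0. *)
  enough (H : Rabs ((gauss x * gauss x + gauss_aux x) - (gauss 0 * gauss 0 + gauss_aux 0)) <= 0 * Rabs (x - 0)).
  { rewrite Rmult_0_l in H. apply Rminus_diag_uniq.
    apply Rabs_eq_0. apply Rle_antisym; [exact H|apply Rabs_pos]. }
  apply (bounded_variation (fun x => gauss x * gauss x + gauss_aux x) (fun _ => 0)).
  intros t _. split; [|rewrite Rabs_R0; lra].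
  evar_last.
  - apply (is_derive_plus (V := R_NormedModule) (fun x => gauss x * gauss x) gauss_aux).
    + apply (is_derive_mult gauss gauss). apply is_derive_gauss. apply is_derive_gauss.
      intros; apply Rmult_comm.
    + apply is_derive_gauss_aux.
  - unfold plus, mult; simpl. unfold mult; simpl. ring.
Qed.

Lemma gauss_aux_bounds (x : R) : 0 <= gauss_aux x <= exp (- (x * x)).
Proof.
  assert (Hc : ex_RInt (fun t => exp (- (x * x * (1 + t * t))) / (1 + t * t)) 0 1).
  { apply (ex_RInt_continuous (V := R_CompleteNormedModule)). intros t _.
    apply (ex_derive_continuous (V := R_NormedModule)). auto_derive. nra. }
  split.
  - apply RInt_ge_0; [lra|exact Hc|]. intros t _.
    apply Rle_mult_inv_pos; [left; apply exp_pos|nra].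
  - replace (exp (- (x * x))) with (RInt (fun _ => exp (- (x * x))) 0 1).
    2:{ rewrite RInt_const. unfold scal; simpl; unfold mult; simpl. ring. }
    apply RInt_le; [lra|exact Hc|apply ex_RInt_const|].
    intros t _.
    assert (H1 : exp (- (x * x * (1 + t * t))) <= exp (- (x * x))).
    { destruct (Req_dec (x * t) 0) as [E|E].
      - right. f_equal. replace (x * x * (1 + t * t)) with (x * x + (x * t) * (x * t)) by ring.
        rewrite E. ring.
      - left. apply exp_increasing. nra. }
    apply Rle_div_l; [nra|]. pose proof (exp_pos (- (x * x))). nra.
Qed.

Lemma gauss_ge_0 (x : R) : 0 <= x -> 0 <= gauss x.
Proof.
  intros Hx. apply RInt_ge_0; [exact Hx| |intros t _; left; apply exp_pos].
  apply (ex_RInt_continuous (V := R_CompleteNormedModule)). intros t _.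
  apply (ex_derive_continuous (V := R_NormedModule)). auto_derive. exact I.
Qed.

Lemma gauss_lim : filterlim gauss (Rbar_locally p_infty) (locally (sqrt PI / 2)).
Proof.
  assert (Hs : sqrt (PI / 4) = sqrt PI / 2).
  { rewrite sqrt_div_alt by lra. f_equal. replace 4 with (2 * 2) by ring. apply sqrt_square. lra. }
  rewrite <- Hs.
  apply (filterlim_ext_loc (fun x => sqrt (PI / 4 - gauss_aux x))).
  { exists 0. intros x Hx. rewrite <- (gauss_sqr x).
    replace (_ - _) with (gauss x * gauss x) by ring.
    apply sqrt_square, gauss_ge_0. lra. }
  apply (filterlim_comp _ _ _ (fun x => PI / 4 - gauss_aux x) sqrt _ (locally (PI / 4))).
  2:{ apply continuous_sqrt. }
  replace (locally (PI / 4)) with (Rbar_locally (PI / 4 - 0)) by (simpl; rewrite Rminus_0_r; reflexivity).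
  apply (is_lim_minus' (fun _ => PI / 4) gauss_aux p_infty (PI / 4) 0).
  apply is_lim_const.
  apply (is_lim_le_le_loc (fun _ => 0) (fun x => exp (- x))).
  - exists 1. intros x Hx. split; [apply gauss_aux_bounds|].
    eapply Rle_trans; [apply gauss_aux_bounds|]. left; apply exp_increasing. nra.
  - apply is_lim_const.
  - evar_last. apply (is_lim_comp exp Ropp p_infty 0 m_infty).
    apply is_lim_exp_m. evar_last. apply is_lim_opp, is_lim_id. reflexivity.
    exists 0. intros; discriminate. reflexivity.
Qed.

(** The values of Gamma at n + 1/2, generated by the functional equation so that algebra on
    coefficients never meets the integral. *)
Fixpoint half_gamma (n : nat) : R :=
  match n with
  | O => sqrt PI
  | S k => (INR k + 1 / 2) * half_gamma k
  end.

Lemma half_gamma_pos (n : nat) : 0 < half_gamma n.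
Proof.
  induction n as [|n IH]; simpl half_gamma.
  - apply sqrt_lt_R0, PI_RGT_0.
  - apply Rmult_lt_0_compat; [|exact IH]. pose proof (pos_INR n). lra.
Qed.

(* Antiderivative of [t^(n+1/2) e^(-t)] on [t > 0] given by repeated integration by parts. *)
Fixpoint gamma_prim (n : nat) (t : R) : R :=
  match n with
  | O => gauss (sqrt t) - sqrt t * exp (- t)
  | S k => (INR k + 3 / 2) * gamma_prim k t - Rpower t (INR k + 3 / 2) * exp (- t)
  end.

Lemma is_derive_gamma_prim (n : nat) (t : R) : 0 < t ->
  is_derive (gamma_prim n) t (Rpower t (INR n + 1 / 2) * exp (- t)).
Proof.
  intros Ht. induction n as [|n IH]; cbn [gamma_prim].
  - evar_last.
    + apply (is_derive_minus (V := R_NormedModule) (fun t => gauss (sqrt t)) (fun t => sqrt t * exp (- t))).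
      * apply (is_derive_comp (V := R_NormedModule) gauss sqrt). apply is_derive_gauss.
        apply is_derive_Reals, derivable_pt_lim_sqrt, Ht.
      * auto_derive. exact Ht. reflexivity.
    + simpl INR. rewrite Rplus_0_l. replace (1 / 2) with (/ 2) by field.
      rewrite Rpower_sqrt by exact Ht. rewrite sqrt_sqrt by lra.
      pose proof (sqrt_lt_R0 t Ht) as Hs.
      unfold scal, minus, plus, opp; simpl. unfold mult; simpl. field. lra.
  - rewrite S_INR. evar_last.
    + apply (is_derive_minus (V := R_NormedModule)
        (fun t => (INR n + 3 / 2) * gamma_prim n t) (fun t => Rpower t (INR n + 3 / 2) * exp (- t))).
      * apply (is_derive_scal (gamma_prim n)), IH.
      * apply (is_derive_mult (fun t => Rpower t (INR n + 3 / 2)) (fun t => exp (- t))).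
        -- apply is_derive_Reals, derivable_pt_lim_power, Ht.
        -- auto_derive. exact I. reflexivity.
        -- intros; apply Rmult_comm.
    + replace (INR n + 1 + 1 / 2) with (INR n + 3 / 2) by field.
      replace (INR n + 3 / 2 - 1) with (INR n + 1 / 2) by field.
      unfold minus, plus, opp, mult; simpl. unfold mult; simpl. ring.
Qed.

(** The limit has to be one-sided and punctured: [ln 0] is 0, so [Rpower 0 a] is 1 and continuity at
    0 fails. *)
Lemma Rpower_0_lim (a : R) : 0 < a ->
  filterlim (fun t => Rpower t a) (at_right 0) (locally 0).
Proof.
  intros Ha P [e He].
  exists (mkposreal (Rpower e (/ a)) (exp_pos _)).
  intros t Ht Ht0. apply He.
  unfold ball in Ht; simpl in Ht. unfold AbsRing_ball, abs, minus, plus, opp in Ht; simpl in Ht.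
  unfold ball; simpl. unfold AbsRing_ball, abs, minus, plus, opp; simpl.
  rewrite Ropp_0, Rplus_0_r in *. rewrite Rabs_pos_eq in Ht by lra.
  rewrite Rabs_pos_eq by (left; apply exp_pos).
  replace (pos e) with (Rpower (Rpower e (/ a)) a).
  - apply Rlt_Rpower_l; lra.
  - rewrite Rpower_mult, Rinv_l, Rpower_1. reflexivity. apply cond_pos. lra.
Qed.

(** One induction serves both ends of Euler's integral: [L] is 0 at the origin and 1 at infinity.
    The boundary terms of the integrations by parts vanish at either end, so only the factors n +
    3/2 accumulate. *)
Lemma gamma_prim_lim (F : (R -> Prop) -> Prop) (L : R) (n : nat) : Filter F ->
  filterlim (gamma_prim 0) F (locally (L * half_gamma 1)) ->
  (forall a, 0 < a -> filterlim (fun t => Rpower t a * exp (- t)) F (locally 0)) ->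
  filterlim (gamma_prim n) F (locally (L * half_gamma (S n))).
Proof.
  intros HF H0 Ha. induction n as [|n IH]; [exact H0|].
  change (gamma_prim (S n)) with
    (fun t => (INR n + 3 / 2) * gamma_prim n t + - (Rpower t (INR n + 3 / 2) * exp (- t))).
  replace (L * half_gamma (S (S n))) with ((INR n + 3 / 2) * (L * half_gamma (S n)) + - 0).
  2:{ cbn [half_gamma]. rewrite S_INR. field. }
  pose proof (pos_INR n).
  apply (filterlim_comp_2 (G := locally ((INR n + 3 / 2) * (L * half_gamma (S n)))) (H := locally (- 0))).
  - apply (filterlim_comp _ _ _ (gamma_prim n) (Rmult (INR n + 3 / 2)) F (locally (L * half_gamma (S n)))).
    exact IH. apply (filterlim_scal_r (V := R_NormedModule)).
  - apply (filterlim_comp _ _ _ (fun t => Rpower t (INR n + 3 / 2) * exp (- t)) Ropp F (locally 0)).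
    apply Ha. lra. apply (filterlim_opp (V := R_NormedModule)).
  - apply (filterlim_plus (V := R_NormedModule)).
Qed.

Lemma gamma_prim_lim_0 (n : nat) : filterlim (gamma_prim n) (at_right 0) (locally 0).
Proof.
  assert (He : continuous (fun t => exp (- t)) 0).
  { apply (ex_derive_continuous (V := R_NormedModule)). auto_derive. exact I. }
  (* [sqrt] is 0 on negative numbers and hence continuous at 0 from both sides; the one-sided limit
     is obtained by restriction. *)
  assert (H0 : continuous (gamma_prim 0) 0).
  { apply (continuous_minus (V := R_NormedModule) (fun t => gauss (sqrt t)) (fun t => sqrt t * exp (- t))).
    - apply (continuous_comp sqrt gauss). apply continuous_sqrt. apply continuous_gauss.
    - apply (continuous_mult sqrt (fun t => exp (- t))). apply continuous_sqrt. exact He. }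
  enough (H : filterlim (gamma_prim n) (at_right 0) (locally (0 * half_gamma (S n)))).
  { rewrite Rmult_0_l in H. exact H. }
  apply gamma_prim_lim.
  - apply at_right_proper_filter.
  - rewrite Rmult_0_l.
    apply (filterlim_filter_le_1 (F := locally 0)).
    { apply filter_le_within. }
    replace 0 with (gamma_prim 0 0) at 2; [exact H0|].
    cbn [gamma_prim]. rewrite sqrt_0, gauss_0. ring.
  - intros a Ha. 
    enough (H : filterlim (fun t => Rpower t a * exp (- t)) (at_right 0) (locally (0 * exp (- 0)))).
    { rewrite Rmult_0_l in H. exact H. }
    eapply filterlim_comp_2; [apply (Rpower_0_lim a Ha)| |apply (filterlim_mult (K := R_AbsRing))].
    apply (filterlim_filter_le_1 (F := locally 0)).
    { apply filter_le_within. }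
    exact He.
Qed.

Lemma Rpower_exp_lim (a : R) : 0 < a ->
  filterlim (fun t => Rpower t a * exp (- t)) (Rbar_locally p_infty) (locally 0).
Proof.
  intros Ha.
  (* The majorant comes from the tangent to [ln] at 2a. That point of contact makes [a * ln t] grow
     with slope at most 1/2 there, leaving exp(-t/2) of the decay. *)
  apply (is_lim_le_le_loc (fun _ => 0) (fun t => exp (a * (ln (2 * a) - 1)) * exp (- / 2 * t)) _ p_infty 0).
  - exists 0. intros t Ht. unfold Rpower. rewrite <- !exp_plus.
    split; [left; apply exp_pos|].
    assert (Hl : ln t <= ln (2 * a) + (t / (2 * a) - 1)).
    { replace t with (2 * a * (t / (2 * a))) at 1 by (field; lra).
      assert (Hp : 0 < t / (2 * a)) by (apply Rdiv_lt_0_compat; lra).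
      rewrite ln_mult by lra.
      pose proof (exp_ineq1_le (ln (t / (2 * a)))) as H. rewrite exp_ln in H by exact Hp. lra. }
    assert (Hl' : a * ln t <= a * (ln (2 * a) + (t / (2 * a) - 1))) by (apply Rmult_le_compat_l; lra).
    replace (a * (ln (2 * a) + (t / (2 * a) - 1))) with (a * (ln (2 * a) - 1) + t / 2) in Hl' by (field; lra).
    destruct (Rle_lt_or_eq_dec (a * ln t + - t) (a * (ln (2 * a) - 1) + - / 2 * t)) as [H|H].
    + lra.
    + left. apply exp_increasing, H.
    + right. f_equal. exact H.
  - apply is_lim_const.
  - evar_last. apply is_lim_scal_l.
    apply (is_lim_comp exp (fun t => - / 2 * t) p_infty 0 m_infty).
    + apply is_lim_exp_m.
    + evar_last. apply is_lim_scal_l, is_lim_id. simpl.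
      destruct (Rle_dec 0 (- / 2)) as [H|H]; [exfalso; lra|reflexivity].
    + exists 0. intros; discriminate.
    + simpl. f_equal. ring.
Qed.

Lemma gamma_prim_lim_infty (n : nat) :
  filterlim (gamma_prim n) (Rbar_locally p_infty) (locally (half_gamma (S n))).
Proof.
  rewrite <- (Rmult_1_l (half_gamma (S n))).
  apply gamma_prim_lim.
  - apply Rbar_locally_filter.
  - replace (1 * half_gamma 1) with (sqrt PI / 2 + - 0) by (simpl; field).
    change (gamma_prim 0) with (fun t => gauss (sqrt t) + - (sqrt t * exp (- t))).
    apply (filterlim_comp_2 (G := locally (sqrt PI / 2)) (H := locally (- 0)));
      [| |apply (filterlim_plus (V := R_NormedModule))].
    + apply (filterlim_comp _ _ _ sqrt gauss _ (Rbar_locally p_infty)); [|apply gauss_lim].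
      apply filterlim_sqrt_p.
    + apply (filterlim_comp _ _ _ (fun t => sqrt t * exp (- t)) Ropp _ (locally 0));
        [|apply (filterlim_opp (V := R_NormedModule))].
      eapply (filterlim_ext_loc (fun t => Rpower t (/ 2) * exp (- t))).
      { exists 0. intros t Ht. rewrite Rpower_sqrt by exact Ht. reflexivity. }
      apply Rpower_exp_lim. lra.
  - apply Rpower_exp_lim.
Qed.

(** The integral is the difference of the two limits of [gamma_prim n]. The argument is tied to n +
    3/2 by an equation so that any expression equal to it can be rewritten. *)
Lemma Gamma_half (n : nat) (x : R) : x = INR n + 3 / 2 -> Gamma x = half_gamma (S n).
Proof.
  intros ->. unfold Gamma. apply is_RInt_gen_unique.
  replace (half_gamma (S n)) with (half_gamma (S n) - 0) by ring.
  assert (Hpos : filter_prod (at_right 0) (Rbar_locally p_infty)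
    (fun ab => forall t, Rmin (fst ab) (snd ab) <= t <= Rmax (fst ab) (snd ab) -> 0 < t)).
  { apply (Filter_prod _ _ _ (fun a => 0 < a) (fun b => 0 < b)).
    - exists (mkposreal 1 Rlt_0_1). intros y _ Hy. exact Hy.
    - exists 0. intros y Hy. exact Hy.
    - intros a b Ha Hb t Ht. simpl in Ht. pose proof (Rmin_glb_lt a b 0 Ha Hb). lra. }
  assert (Hloc : forall t, 0 < t -> locally t (fun y =>
     Derive (gamma_prim n) y = Rpower y (INR n + 1 / 2) * exp (- y))).
  { intros t Ht. generalize (open_gt 0 t Ht). apply filter_imp. intros y Hy.
    apply is_derive_unique, is_derive_gamma_prim, Hy. }
  apply (is_RInt_gen_ext (Derive (gamma_prim n))).
  { revert Hpos. apply filter_imp. intros ab H t Ht.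
    rewrite (locally_singleton _ _ (Hloc t (H t ltac:(lra)))).
    do 2 f_equal. field. }
  apply is_RInt_gen_Derive.
  - revert Hpos. apply filter_imp. intros ab H t Ht. eexists. apply is_derive_gamma_prim, H, Ht.
  - revert Hpos. apply filter_imp. intros ab H t Ht.
    apply (continuous_ext_loc _ (fun y => Rpower y (INR n + 1 / 2) * exp (- y))).
    { generalize (Hloc t (H t Ht)). apply filter_imp. intros y E. symmetry. exact E. }
    apply (ex_derive_continuous (V := R_NormedModule)). unfold Rpower. auto_derive. exact (H t Ht).
  - apply gamma_prim_lim_0.
  - apply gamma_prim_lim_infty.
Qed.

Open Scope C_scope.

(** * Complex-valued functions of a real variable *)

(** Restates an equation typed in a Coquelicot structure as one in [C], where [ring] applies. *)
Ltac Cring := match goal with |- ?a = ?b => change (@eq C a b); ring end.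

Lemma C_eq (z1 z2 : C) : Re z1 = Re z2 -> Im z1 = Im z2 -> z1 = z2.
Proof. destruct z1, z2. simpl. intros -> ->. reflexivity. Qed.

Lemma Cmod_le_Re_Im (z : C) : (Cmod z <= Rabs (Re z) + Rabs (Im z))%R.
Proof.
  replace z with (RtoC (Re z) + Ci * RtoC (Im z)) at 1 by (unfold Ci; apply C_eq; simpl; ring).
  eapply Rle_trans; [apply Cmod_triangle|].
  rewrite Cmod_mult, Cmod_Ci, !Cmod_R. lra.
Qed.

Lemma Cexp_add (a b : C) : Cexp (a + b) = Cexp a * Cexp b.
Proof.
  destruct a, b. unfold Cexp. apply C_eq; simpl; rewrite exp_plus, ?cos_plus, ?sin_plus; ring.
Qed.

Lemma Cexp_0 : Cexp 0 = 1.
Proof. unfold Cexp. simpl. rewrite exp_0, cos_0, sin_0. apply C_eq; simpl; ring.  Qed.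

Lemma Cexp_opp (a : C) : Cexp (- a) * Cexp a = 1.
Proof. rewrite <- Cexp_add, Cplus_comm, Cplus_opp_r. apply Cexp_0. Qed.

Lemma Cmod_Cexp (z : C) : Cmod (Cexp z) = exp (Re z).
Proof.
  unfold Cmod, Cexp; cbn [fst snd].
  replace (_ + _)%R with (exp (Re z) * exp (Re z))%R.
  - apply sqrt_square. left. apply exp_pos.
  - pose proof (sin2_cos2 (Im z)) as E. unfold Rsqr in E.
    transitivity (exp (Re z) * exp (Re z) * (sin (Im z) * sin (Im z) + cos (Im z) * cos (Im z)))%R.
    rewrite E; ring. ring.
Qed.

Lemma Cmod_Cexp_le (z : C) : (Cmod (Cexp z) <= exp (Cmod z))%R.
Proof.
  rewrite Cmod_Cexp.
  assert (H : (Re z <= Cmod z)%R) by (eapply Rle_trans; [apply Rle_abs|apply re_le_Cmod]).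
  destruct H as [H|H].
  - left. apply exp_increasing, H.
  - rewrite H. lra.
Qed.

(** Componentwise, so that the real chain rule, fundamental theorem and mean value inequality apply
    without any complex differentiability. *)
Definition is_Cderive (f : R -> C) (t : R) (l : C) : Prop :=
  is_derive (fun s => Re (f s)) t (Re l) /\ is_derive (fun s => Im (f s)) t (Im l).

Lemma is_Cderive_eq (f : R -> C) (t : R) (l1 l2 : C) :
  is_Cderive f t l1 -> l1 = l2 -> is_Cderive f t l2.
Proof. intros H <-. exact H. Qed.

Lemma is_Cderive_ext (f g : R -> C) (t : R) (l : C) :
  (forall s, f s = g s) -> is_Cderive f t l -> is_Cderive g t l.
Proof.
  intros E [H1 H2]. split.
  - eapply is_derive_ext; [|exact H1]. intros s. simpl. rewrite E. reflexivity.
  - eapply is_derive_ext; [|exact H2]. intros s. simpl. rewrite E. reflexivity.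
Qed.

Lemma is_Cderive_const (c : C) (t : R) : is_Cderive (fun _ => c) t 0.
Proof. split; apply (is_derive_const (V := R_NormedModule)). Qed.

Lemma is_Cderive_RtoC (f : R -> R) (t l : R) :
  is_derive f t l -> is_Cderive (fun s => RtoC (f s)) t (RtoC l).
Proof. intros H. split. exact H. exact (is_derive_const (V := R_NormedModule) 0%R t). Qed.

Lemma is_Cderive_plus (f g : R -> C) (t : R) (lf lg : C) :
  is_Cderive f t lf -> is_Cderive g t lg ->
  is_Cderive (fun s => f s + g s) t (lf + lg).
Proof.
  intros [F1 F2] [G1 G2]. split.
  - exact (is_derive_plus (V := R_NormedModule) _ _ _ _ _ F1 G1).
  - exact (is_derive_plus (V := R_NormedModule) _ _ _ _ _ F2 G2).
Qed.

Lemma is_Cderive_mult (f g : R -> C) (t : R) (lf lg : C) :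
  is_Cderive f t lf -> is_Cderive g t lg ->
  is_Cderive (fun s => f s * g s) t (lf * g t + f t * lg).
Proof.
  intros [F1 F2] [G1 G2].
  pose proof (fun (a b : R -> R) (x la lb : R) A B => is_derive_mult a b x la lb A B Rmult_comm) as M.
  split.
  - evar_last.
    + exact (is_derive_minus (V := R_NormedModule) _ _ _ _ _ (M _ _ _ _ _ F1 G1) (M _ _ _ _ _ F2 G2)).
    + unfold minus, plus, opp, mult; simpl. unfold mult, Re, Im; simpl. ring.
  - evar_last.
    + exact (is_derive_plus (V := R_NormedModule) _ _ _ _ _ (M _ _ _ _ _ F1 G2) (M _ _ _ _ _ F2 G1)).
    + unfold minus, plus, opp, mult; simpl. unfold mult, Re, Im; simpl. ring.
Qed.

Lemma is_Cderive_scal (c : C) (f : R -> C) (t : R) (l : C) :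
  is_Cderive f t l -> is_Cderive (fun s => c * f s) t (c * l).
Proof.
  intros H. eapply is_Cderive_eq.
  - apply is_Cderive_mult. apply is_Cderive_const. exact H.
  - cbv beta. ring.
Qed.

Lemma is_Cderive_Cexp (f : R -> C) (t : R) (l : C) :
  is_Cderive f t l -> is_Cderive (fun s => Cexp (f s)) t (l * Cexp (f t)).
Proof.
  intros [H1 H2].
  assert (E1 : is_derive (fun s => exp (Re (f s))) t (Re l * exp (Re (f t)))%R).
  { apply (is_derive_comp (V := R_NormedModule) exp _ t). apply is_derive_exp. exact H1. }
  assert (E2 : is_derive (fun s => cos (Im (f s))) t (Im l * - sin (Im (f t)))%R).
  { apply (is_derive_comp (V := R_NormedModule) cos _ t). apply is_derive_cos. exact H2. }
  assert (E3 : is_derive (fun s => sin (Im (f s))) t (Im l * cos (Im (f t)))%R).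
  { apply (is_derive_comp (V := R_NormedModule) sin _ t). apply is_derive_sin. exact H2. }
  pose proof (fun (a b : R -> R) (x la lb : R) A B => is_derive_mult a b x la lb A B Rmult_comm) as M.
  split.
  - evar_last. exact (M _ _ _ _ _ E1 E2). unfold plus, mult; simpl. unfold mult, Re, Im; simpl. ring.
  - evar_last. exact (M _ _ _ _ _ E1 E3). unfold plus, mult; simpl. unfold mult, Re, Im; simpl. ring.
Qed.

(** The two components are estimated separately and added, which costs the factor 2; it is harmless
    because [D] will tend to 0. *)
Lemma Cmean_value (f df : R -> C) (D x y : R) :
  (forall t, (Rabs (t - x) <= Rabs (y - x))%R -> is_Cderive f t (df t) /\ (Cmod (df t) <= D)%R) ->
  (Cmod (f y - f x) <= 2 * D * Rabs (y - x))%R.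
Proof.
  intros H.
  assert (H1 : (Rabs (Re (f y) - Re (f x)) <= D * Rabs (y - x))%R).
  { apply (bounded_variation (fun s => Re (f s)) (fun s => Re (df s))).
    intros t Ht. destruct (H t Ht) as [[F1 F2] B]. split; [exact F1|].
    eapply Rle_trans; [apply re_le_Cmod|exact B]. }
  assert (H2 : (Rabs (Im (f y) - Im (f x)) <= D * Rabs (y - x))%R).
  { apply (bounded_variation (fun s => Im (f s)) (fun s => Im (df s))).
    intros t Ht. destruct (H t Ht) as [[F1 F2] B]. split; [exact F2|].
    eapply Rle_trans; [|exact B]. eapply Rle_trans; [|apply Rmax_Cmod]. apply Rmax_r. }
  eapply Rle_trans; [apply Cmod_le_Re_Im|].
  change (Re (f y - f x)) with (Re (f y) - Re (f x))%R.
  change (Im (f y - f x)) with (Im (f y) - Im (f x))%R.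
  lra.
Qed.

Lemma is_series_C_bound (a : nat -> C) (l : C) (b : nat -> R) :
  (forall n, Cmod (sum_n a n - l) <= b n)%R -> is_lim_seq b 0 -> is_series a l.
Proof.
  intros H Hb. apply filterlim_locally. intros eps.
  apply is_lim_seq_spec in Hb. destruct (Hb eps) as [N HN].
  exists N. intros n Hn. specialize (HN n Hn). rewrite Rminus_0_r in HN.
  assert (Hlt : (Cmod (sum_n a n - l) < eps)%R).
  { eapply Rle_lt_trans; [apply H|]. eapply Rle_lt_trans; [apply Rle_abs|exact HN]. }
  pose proof (Rmax_Cmod (sum_n a n - l)) as HM.
  split; eapply Rle_lt_trans; try exact Hlt; (eapply Rle_trans; [|exact HM]).
  - apply Rmax_l.
  - apply Rmax_r.
Qed.

Lemma sum_n_Re_Im (a : nat -> C) (n : nat) :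
  sum_n a n = (sum_n (fun k => Re (a k)) n, sum_n (fun k => Im (a k)) n).
Proof.
  induction n as [|n IH].
  - rewrite !sum_O. apply C_eq; reflexivity.
  - rewrite !sum_Sn, IH. reflexivity.
Qed.

Lemma CSeries_unique (a : nat -> C) (l : C) : is_series a l -> CSeries a = l.
Proof.
  intros H. unfold CSeries. apply C_eq; apply is_series_unique.
  - apply (filterlim_ext (fun n => fst (sum_n a n))).
    { intros n. rewrite sum_n_Re_Im. reflexivity. }
    apply (filterlim_comp _ _ _ (sum_n a) fst _ (locally l)). exact H.
    destruct l as [x y]. apply (continuous_fst (U := R_UniformSpace) (V := R_UniformSpace)).
  - apply (filterlim_ext (fun n => snd (sum_n a n))).
    { intros n. rewrite sum_n_Re_Im. reflexivity. }
    apply (filterlim_comp _ _ _ (sum_n a) snd _ (locally l)). exact H.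
    destruct l as [x y]. apply (continuous_snd (U := R_UniformSpace) (V := R_UniformSpace)).
Qed.

Lemma CSeries_correct (a : nat -> C) (b : nat -> R) :
  (forall n, Cmod (a n) <= b n)%R -> ex_series b -> is_series a (CSeries a).
Proof.
  intros H Hb.
  destruct (ex_series_le (V := C_CompleteNormedModule) a b H Hb) as [l Hl].
  rewrite (CSeries_unique a l Hl). exact Hl.
Qed.

Lemma Cmod_sum_n_le (a : nat -> C) (b : nat -> R) (n : nat) :
  (forall n, Cmod (a n) <= b n)%R -> (Cmod (sum_n a n) <= sum_n b n)%R.
Proof.
  intros H. induction n as [|n IH].
  - rewrite !sum_O. apply H.
  - rewrite !sum_Sn. eapply Rle_trans; [apply Cmod_triangle|].
    apply Rplus_le_compat. exact IH. apply H.
Qed.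

Lemma Cmod_series_le (a : nat -> C) (b : nat -> R) (l : C) (lb : R) :
  (forall n, Cmod (a n) <= b n)%R -> is_series a l -> is_series b lb -> (Cmod l <= lb)%R.
Proof.
  intros H Ha Hb.
  apply (filterlim_le (F := eventually) (fun n => norm (sum_n a n)) (sum_n b) (Cmod l) lb).
  - apply filter_forall. intros n. apply Cmod_sum_n_le, H.
  - eapply filterlim_comp. exact Ha. apply (filterlim_norm (K := C_AbsRing) (V := C_NormedModule)).
  - exact Hb.
Qed.

Lemma is_series_exp (x : R) : is_series (fun n => x ^ n / INR (fact n))%R (exp x).
Proof.
  eapply is_series_ext; [|exact (is_exp_Reals x)].
  intros n. simpl. rewrite pow_n_pow. reflexivity.
Qed.

Lemma pow_div_fact_lim (x : R) : is_lim_seq (fun n => x ^ n / INR (fact n))%R 0.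
Proof. apply ex_series_lim_0. eexists. apply is_series_exp. Qed.

(* [exp(-sz)] times the partial sum of [exp(sz)] has derivative [- z e^{-sz} (sz)^n / n!] in [s]. *)
Lemma is_series_Cexp (z : C) : is_series (fun n => z ^ n / RtoC (INR (fact n))) (Cexp z).
Proof.
  pose (P (n : nat) (s : R) := sum_n (fun k => RtoC (s ^ k / INR (fact k)) * z ^ k) n : C).
  assert (HD : forall n s, is_derive (fun s => s ^ (S n) / INR (fact (S n)))%R s (s ^ n / INR (fact n))%R).
  { intros n s. auto_derive. exact I.
    change (fact n + n * fact n)%nat with (S n * fact n)%nat.
    change (match n with O => 1%R | S _ => (INR n + 1)%R end) with (INR (S n)).
    rewrite mult_INR. field.
    split; [apply INR_fact_neq_0|apply not_0_INR; lia]. }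
  assert (HP : forall n s, is_Cderive (P n) s (z * P n s - z * (RtoC (s ^ n / INR (fact n)) * z ^ n))).
  { intros n s. induction n as [|n IH].
    - apply (is_Cderive_ext (fun _ => 1)).
      { intros t. unfold P. rewrite sum_O. apply C_eq; simpl; field. }
      eapply is_Cderive_eq; [apply is_Cderive_const|]. unfold P. rewrite sum_O. ring.
    - apply (is_Cderive_ext (fun s => P n s + z ^ (S n) * RtoC (s ^ (S n) / INR (fact (S n))))).
      { intros t. unfold P. rewrite sum_Sn. rewrite (Cmult_comm (z ^ _)). reflexivity. }
      eapply is_Cderive_eq.
      + apply is_Cderive_plus. exact IH. apply is_Cderive_scal, is_Cderive_RtoC, HD.
      + unfold P at 2. rewrite sum_Sn. fold (P n s).
        change (plus (P n s) ?x) with (P n s + x).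
        rewrite !Cpow_S. ring. }
  apply (is_series_C_bound _ _
     (fun n => (exp (Cmod z) * (2 * (Cmod z * exp (Cmod z)))) * (Cmod z ^ n / INR (fact n)))%R).
  2:{ evar_last. apply is_lim_seq_scal_l, pow_div_fact_lim. simpl. f_equal. ring. }
  intros n.
  assert (E : sum_n (fun n => z ^ n / RtoC (INR (fact n))) n = P n 1%R).
  { apply sum_n_ext. intros k. rewrite pow1. rewrite RtoC_div by apply INR_fact_neq_0.
    unfold Cdiv. Cring. }
  rewrite E.
  assert (E0 : P n 0%R = 1).
  { unfold P. clear. induction n as [|n IH].
    - rewrite sum_O. apply C_eq; simpl; field.
    - rewrite sum_Sn, IH. rewrite pow_ne_zero by lia. unfold Rdiv. rewrite Rmult_0_l, Cmult_0_l.
      apply Cplus_0_r. }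
  (* From s = 0 to s = 1 the product moves from 1 to [Cexp (- z) * P n 1], so the error of the
     partial sum is [Cexp z] times this increment. *)
  pose proof (Cmean_value (fun s => Cexp (- (RtoC s * z)) * P n s)
     (fun s => - z * Cexp (- (RtoC s * z)) * (RtoC (s ^ n / INR (fact n)) * z ^ n))
     (Cmod z * exp (Cmod z) * (Cmod z ^ n / INR (fact n))) 0 1) as MV.
  cbv beta in MV.
  rewrite E0 in MV.
  replace (- (0%R * z)) with (RtoC 0) in MV by ring.
  replace (- (1%R * z)) with (- z) in MV by ring.
  rewrite Cexp_0 in MV.
  replace (P n 1%R - Cexp z) with (Cexp z * (Cexp (- z) * P n 1%R - 1 * 1)).
  2:{ pose proof (Cexp_opp z) as Ez.
      transitivity ((Cexp (- z) * Cexp z) * P n 1%R - Cexp z). ring. rewrite Ez. ring. }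
  rewrite Cmod_mult, !Rmult_assoc.
  apply Rmult_le_compat; try apply Cmod_ge_0. apply Cmod_Cexp_le.
  eapply Rle_trans; [apply MV|].
  2:{ rewrite Rminus_0_r, Rabs_R1. right. ring. }
  intros t Ht. rewrite Rminus_0_r, Rminus_0_r, Rabs_R1 in Ht. split.
  - eapply is_Cderive_eq.
    + apply is_Cderive_mult; [|apply HP]. apply is_Cderive_Cexp.
      apply (is_Cderive_ext (fun s => - z * RtoC s)). intros s; ring.
      apply is_Cderive_scal, is_Cderive_RtoC. apply (is_derive_id (K := R_AbsRing)).
    + change (RtoC one) with (RtoC 1). cbv beta. ring.
  - rewrite !Cmod_mult, Cmod_opp, Cmod_pow, Cmod_R.
    assert (Hf : (0 < INR (fact n))%R) by apply INR_fact_lt_0.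
    assert (B1 : (Cmod (Cexp (- (RtoC t * z))) <= exp (Cmod z))%R).
    { eapply Rle_trans; [apply Cmod_Cexp_le|]. rewrite Cmod_opp, Cmod_mult, Cmod_R.
      assert (B : (Rabs t * Cmod z <= Cmod z)%R) by (pose proof (Cmod_ge_0 z); nra).
      destruct B as [B|B]; [left; apply exp_increasing, B|rewrite B; lra]. }
    assert (B2 : (Rabs (t ^ n / INR (fact n)) * Cmod z ^ n <= Cmod z ^ n / INR (fact n))%R).
    { unfold Rdiv. rewrite Rabs_mult, <- RPow_abs, (Rabs_pos_eq (/ _)).
      2:{ left. apply Rinv_0_lt_compat, Hf. }
      rewrite <- (Rmult_1_l (Cmod z ^ n * _)), Rmult_assoc, (Rmult_comm (/ _)).
      apply Rmult_le_compat_r.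
      - apply Rmult_le_pos. apply pow_le, Cmod_ge_0. left. apply Rinv_0_lt_compat, Hf.
      - rewrite <- (pow1 n). apply pow_incr. split; [apply Rabs_pos|exact Ht]. }
    apply Rmult_le_compat; try exact B2.
    + apply Rmult_le_pos; apply Cmod_ge_0.
    + apply Rmult_le_pos; [apply Rabs_pos|apply pow_le, Cmod_ge_0].
    + apply Rmult_le_compat_l; [apply Cmod_ge_0|exact B1].
Qed.

(** * Half-integer powers *)

(** The sine of [acos] yields only the modulus of Im z divided by that of z; the case split in
    [Carg] restores the sign. *)
Lemma Cexp_Clog (z : C) : z <> 0 -> Cexp (Clog z) = z.
Proof.
  intros Hz. pose proof (Cmod_gt_0 z) as [Hm _]. specialize (Hm Hz).
  assert (Hsq : (Cmod z * Cmod z = Re z * Re z + Im z * Im z)%R).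
  { unfold Cmod. rewrite sqrt_sqrt. unfold Re, Im. ring. nra. }
  assert (Hb : (-1 <= Re z / Cmod z <= 1)%R).
  { pose proof (re_le_Cmod z) as H. apply Rabs_le_between in H.
    split; [apply Rle_div_r|apply Rle_div_l]; lra. }
  assert (Hs : (sqrt (1 - (Re z / Cmod z)²) = Rabs (Im z) / Cmod z)%R).
  { replace (1 - (Re z / Cmod z)²)%R with ((Rabs (Im z) / Cmod z) * (Rabs (Im z) / Cmod z))%R.
    - apply sqrt_square. apply Rle_mult_inv_pos; [apply Rabs_pos|exact Hm].
    - unfold Rsqr.
      replace (Rabs (Im z) / Cmod z * (Rabs (Im z) / Cmod z))%R with ((Rabs (Im z) * Rabs (Im z)) / (Cmod z * Cmod z))%R by (field; lra).
      rewrite <- Rabs_mult, Rabs_pos_eq by nra.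
      replace (Im z * Im z)%R with (Cmod z * Cmod z - Re z * Re z)%R by lra. field. lra. }
  unfold Cexp, Clog. cbn [Re Im fst snd]. change (Re (?a, ?b)) with a. change (Im (?a, ?b)) with b.
  rewrite exp_ln by exact Hm. unfold Carg.
  destruct (Rle_dec 0 (Im z)) as [H|H].
  - rewrite cos_acos, sin_acos, Hs, Rabs_pos_eq by assumption.
    apply C_eq; simpl; field; lra.
  - rewrite cos_neg, sin_neg, cos_acos, sin_acos, Hs, Rabs_left by (assumption || lra).
    apply C_eq; simpl; field; lra.
Qed.

(** A positive factor leaves the argument unchanged, so no multiple of 2 pi i enters. *)
Lemma Clog_scal (a : R) (z : C) : (0 < a)%R -> z <> 0 ->
  Clog (RtoC a * z) = RtoC (ln a) + Clog z.
Proof.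
  intros Ha Hz. pose proof (Cmod_gt_0 z) as [Hm _]. specialize (Hm Hz).
  unfold Clog. rewrite Cmod_mult, Cmod_R, Rabs_pos_eq, ln_mult by lra.
  assert (E : Carg (RtoC a * z) = Carg z).
  { unfold Carg. rewrite Cmod_mult, Cmod_R, Rabs_pos_eq by lra.
    change (Re (RtoC a * z)) with (a * Re z - 0 * Im z)%R.
    change (Im (RtoC a * z)) with (a * Im z + 0 * Re z)%R.
    replace ((a * Re z - 0 * Im z) / (a * Cmod z))%R with (Re z / Cmod z)%R by (field; lra).
    destruct (Rle_dec 0 (a * Im z + 0 * Re z)), (Rle_dec 0 (Im z)); try reflexivity; exfalso; nra. }
  rewrite E. apply C_eq; simpl; ring.
Qed.

Lemma Cpower_neq_0 (z : C) (a : R) : z <> 0 -> Cpower z a = Cexp (RtoC a * Clog z).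
Proof. intros Hz. unfold Cpower. destruct (Ceq_dec z 0); [contradiction|reflexivity]. Qed.

Lemma Cexp_pow (z : C) (n : nat) : Cexp (RtoC (INR n) * z) = Cexp z ^ n.
Proof.
  induction n as [|n IH].
  - simpl INR. rewrite Cmult_0_l, Cexp_0. reflexivity.
  - rewrite S_INR, RtoC_plus, Cpow_S, <- IH, <- Cexp_add. f_equal. ring.
Qed.

Lemma Csqrt_sqr (z : C) : z <> 0 -> Csqrt z * Csqrt z = z.
Proof.
  intros Hz. unfold Csqrt. rewrite Cpower_neq_0 by exact Hz. rewrite <- Cexp_add.
  rewrite <- Cmult_plus_distr_r, <- RtoC_plus.
  replace (1 / 2 + 1 / 2)%R with 1%R by field. rewrite Cmult_1_l. apply Cexp_Clog, Hz.
Qed.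

(** The branch is confined to a single square root common to all orders; the integer part of the
    exponent gives an ordinary power. *)
Lemma Cpower_half_integer (z : C) (n : nat) : z <> 0 ->
  Cpower z (INR n + 1 / 2) = Csqrt z * z ^ n.
Proof.
  intros Hz. unfold Csqrt. rewrite !Cpower_neq_0 by exact Hz.
  rewrite RtoC_plus, Cmult_plus_distr_r, Cexp_add, Cexp_pow, Cexp_Clog by exact Hz. ring.
Qed.

(** This settles the sign: the root of w^2/4 that occurs in the Bessel functions is w/2. *)
Lemma Csqrt_div_4 (z : C) : z <> 0 -> Csqrt (RtoC (/ 4) * z) = Csqrt z / 2.
Proof.
  intros Hz.
  assert (H4 : RtoC (/ 4) <> 0) by (intros E; apply RtoC_inj in E; lra).
  unfold Csqrt. rewrite !Cpower_neq_0; [|exact Hz|apply Cmult_neq_0; assumption].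
  rewrite Clog_scal by (lra || exact Hz).
  rewrite Cmult_plus_distr_l, Cexp_add.
  replace (Cexp (RtoC (1 / 2) * RtoC (ln (/ 4)))) with (/ 2); [unfold Cdiv; ring|].
  rewrite <- RtoC_mult, <- RtoC_inv by lra.
  replace (1 / 2 * ln (/ 4))%R with (- ln 2)%R.
  - unfold Cexp. change (Re (RtoC ?x)) with x. change (Im (RtoC ?x)) with 0%R.
    rewrite cos_0, sin_0, exp_Ropp, exp_ln by lra. apply C_eq; simpl; ring.
  - replace 4%R with (2 * 2)%R by ring. rewrite ln_Rinv, ln_mult by lra. field.
Qed.

(** * Reduced Bessel series *)

Definition bessel_term (q : C) (n k : nat) : C :=
  q ^ (2 * k) / RtoC (INR (fact k) * half_gamma (n + k)).

(* [I_(n-1/2)(2q) = sqrt q ^ (2n-1) * bessel_red q n]. *)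
Definition bessel_red (q : C) (n : nat) : C := CSeries (bessel_term q n).

Lemma fact_half_gamma_neq_0 (n k : nat) : (INR (fact k) * half_gamma n <> 0)%R.
Proof.
  apply Rmult_integral_contrapositive_currified. apply INR_fact_neq_0.
  apply Rgt_not_eq, half_gamma_pos.
Qed.

Lemma bessel_term_eq (q : C) (n k : nat) :
  bessel_term q n k = q ^ (2 * k) * RtoC (/ (INR (fact k) * half_gamma (n + k))).
Proof.
  unfold bessel_term, Cdiv. rewrite RtoC_inv. reflexivity. apply fact_half_gamma_neq_0.
Qed.

(** Factor by factor, n + 1 is at most 2 (n + 1/2). The loss of 2^n is affordable against a
    factorial. *)
Lemma half_gamma_ge (n : nat) : (INR (fact n) * sqrt PI <= 2 ^ n * half_gamma n)%R.
Proof.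
  induction n as [|n IH].
  - simpl. lra.
  - rewrite fact_simpl, mult_INR, S_INR. cbn [half_gamma pow].
    pose proof (pos_INR n).
    assert (0 <= INR n * (2 ^ n * half_gamma n))%R.
    { apply Rmult_le_pos; [lra|]. apply Rmult_le_pos; [apply pow_le; lra|].
      left. apply half_gamma_pos. }
    apply (Rmult_le_compat_l (INR n + 1)) in IH; lra.
Qed.

Lemma half_gamma_inv_le (n : nat) : (/ half_gamma n <= 2 ^ n / INR (fact n) / sqrt PI)%R.
Proof.
  pose proof (half_gamma_ge n). pose proof (half_gamma_pos n). pose proof (INR_fact_lt_0 n).
  assert (0 < sqrt PI)%R by apply sqrt_lt_R0, PI_RGT_0.
  assert (0 < INR (fact n) * sqrt PI)%R by (apply Rmult_lt_0_compat; assumption).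
  replace (2 ^ n / INR (fact n) / sqrt PI)%R with ((2 ^ n * half_gamma n) / (INR (fact n) * sqrt PI) * / half_gamma n)%R
    by (field; lra).
  rewrite <- (Rmult_1_l (/ half_gamma n)) at 1.
  apply Rmult_le_compat_r. left; apply Rinv_0_lt_compat; assumption.
  apply Rle_div_r; lra.
Qed.

Lemma fact_le_add (n k : nat) : (INR (fact n) <= INR (fact (n + k)))%R.
Proof. apply le_INR, fact_le. lia. Qed.

(** The bound separates n from k: 1/k! makes the sum over k an exponential, while 1/n!, kept from
    the Gamma factor, later beats the power q^n of the boundary terms. *)
Lemma Cmod_bessel_term (q : C) (n k : nat) :
  (Cmod (bessel_term q n k) <= 2 ^ n / INR (fact n) / sqrt PI * ((2 * (Cmod q * Cmod q)) ^ k / INR (fact k)))%R.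
Proof.
  rewrite bessel_term_eq, Cmod_mult, Cmod_pow, Cmod_R.
  pose proof (half_gamma_pos (n + k)) as Hg. pose proof (INR_fact_lt_0 k) as Hk.
  pose proof (INR_fact_lt_0 n) as Hn. pose proof (INR_fact_lt_0 (n + k)) as Hnk.
  assert (Hpi : (0 < sqrt PI)%R) by apply sqrt_lt_R0, PI_RGT_0.
  rewrite Rabs_pos_eq by (left; apply Rinv_0_lt_compat, Rmult_lt_0_compat; assumption).
  assert (H2 : (/ half_gamma (n + k) <= 2 ^ n / INR (fact n) / sqrt PI * 2 ^ k)%R).
  { eapply Rle_trans; [apply half_gamma_inv_le|].
    rewrite pow_add. unfold Rdiv.
    assert (/ INR (fact (n + k)) <= / INR (fact n))%R by (apply Rinv_le_contravar; [assumption|apply fact_le_add]).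
    replace (2 ^ n * / INR (fact n) * / sqrt PI * 2 ^ k)%R with (2 ^ n * 2 ^ k * / INR (fact n) * / sqrt PI)%R by ring.
    apply Rmult_le_compat_r. left; apply Rinv_0_lt_compat; assumption.
    apply Rmult_le_compat_l; [|assumption].
    left; apply Rmult_lt_0_compat; apply pow_lt; lra. }
  rewrite Rinv_mult, !Rpow_mult_distr, pow_mult.
  replace (Cmod q ^ 2)%R with (Cmod q * Cmod q)%R by ring.
  rewrite Rpow_mult_distr.
  pose proof (pow_le (Cmod q) k (Cmod_ge_0 q)) as Hq.
  replace (2 ^ n / INR (fact n) / sqrt PI * (2 ^ k * (Cmod q ^ k * Cmod q ^ k) / INR (fact k)))%R
    with (Cmod q ^ k * Cmod q ^ k * (/ INR (fact k) * (2 ^ n / INR (fact n) / sqrt PI * 2 ^ k)))%R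
    by (field; lra).
  apply Rmult_le_compat_l; [nra|].
  apply Rmult_le_compat_l; [left; apply Rinv_0_lt_compat; assumption|exact H2].
Qed.

Lemma is_series_bessel_bound (q : C) (n : nat) :
  is_series (fun k => 2 ^ n / INR (fact n) / sqrt PI * ((2 * (Cmod q * Cmod q)) ^ k / INR (fact k)))%R
    (2 ^ n / INR (fact n) / sqrt PI * exp (2 * (Cmod q * Cmod q)))%R.
Proof. apply (is_series_scal (V := R_NormedModule)), is_series_exp. Qed.

Lemma is_series_bessel_red (q : C) (n : nat) : is_series (bessel_term q n) (bessel_red q n).
Proof.
  eapply CSeries_correct. apply Cmod_bessel_term. eexists. apply is_series_bessel_bound.
Qed.

Lemma Cmod_bessel_red (q : C) (n : nat) :
  (Cmod (bessel_red q n) <= 2 ^ n / INR (fact n) / sqrt PI * exp (2 * (Cmod q * Cmod q)))%R.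
Proof.
  eapply Cmod_series_le. apply Cmod_bessel_term. apply is_series_bessel_red. apply is_series_bessel_bound.
Qed.

Lemma pow_bessel_red_lim (q : C) : is_lim_seq (fun n => Cmod q ^ n * Cmod (bessel_red q n))%R 0.
Proof.
  apply (is_lim_seq_le_le (fun _ => 0%R) _
    (fun n => (exp (2 * (Cmod q * Cmod q)) / sqrt PI) * ((2 * Cmod q) ^ n / INR (fact n)))%R).
  - intros n. pose proof (pow_le (Cmod q) n (Cmod_ge_0 q)) as Hq. split.
    + apply Rmult_le_pos; [exact Hq|apply Cmod_ge_0].
    + eapply Rle_trans; [apply Rmult_le_compat_l; [exact Hq|apply Cmod_bessel_red]|].
      right. rewrite Rpow_mult_distr. field.
      split; [apply INR_fact_neq_0|apply Rgt_not_eq, sqrt_lt_R0, PI_RGT_0].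
  - apply is_lim_seq_const.
  - evar_last. apply is_lim_seq_scal_l, pow_div_fact_lim. simpl. f_equal. ring.
Qed.

(* [I_(nu-1)(x) - I_(nu+1)(x) = (2 nu / x) I_nu(x)] at [nu = n + 1/2]. *)
Lemma bessel_red_rec (q : C) (n : nat) :
  RtoC (INR n + 1 / 2) * bessel_red q (S n) = bessel_red q n - q * q * bessel_red q (S (S n)).
Proof.
  pose (a k := bessel_term q n k + - RtoC (INR n + 1 / 2) * bessel_term q (S n) k).
  assert (Ha : is_series a (bessel_red q n + - RtoC (INR n + 1 / 2) * bessel_red q (S n))).
  { apply (is_series_plus (V := C_NormedModule)). apply is_series_bessel_red.
    apply (is_series_scal (V := C_NormedModule)), is_series_bessel_red. }
  assert (Hfac : forall x A B c, x * RtoC A + - RtoC c * (x * RtoC B) = x * RtoC (A - c * B)).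
  { intros. rewrite RtoC_minus, RtoC_mult. ring. }
  (* By the functional equation the k-th coefficient of [a] is k / (k! Gamma(n+k+3/2)): it vanishes
     at k = 0, and shifting k by one yields q^2 times the series of H_(n+2). *)
  assert (Ha0 : a 0%nat = 0).
  { unfold a. rewrite !bessel_term_eq, !Nat.add_0_r. cbn [Nat.mul Nat.add half_gamma].
    rewrite Hfac. replace (_ - _)%R with 0%R. ring.
    pose proof (half_gamma_pos n). pose proof (pos_INR n). simpl (INR (fact 0)). field. lra. }
  assert (HaS : forall k, q * q * bessel_term q (S (S n)) k = a (S k)).
  { intros k. unfold a. rewrite !bessel_term_eq.
    replace (2 * S k)%nat with (S (S (2 * k))) by lia. rewrite !Cpow_S.
    replace (n + S k)%nat with (S (n + k)) by lia.
    replace (S n + S k)%nat with (S (S (n + k))) by lia.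
    replace (S (S n) + k)%nat with (S (S (n + k))) by lia.
    rewrite Hfac. replace (_ - _)%R with (/ (INR (fact k) * half_gamma (S (S (n + k)))))%R. ring.
    rewrite fact_simpl, mult_INR. cbn [half_gamma]. rewrite !S_INR, plus_INR.
    pose proof (half_gamma_pos (n + k)). pose proof (pos_INR n). pose proof (pos_INR k).
    pose proof (INR_fact_lt_0 k). field. lra. }
  assert (Hs : is_series (fun k => a (S k)) (bessel_red q n + - RtoC (INR n + 1 / 2) * bessel_red q (S n))).
  { apply is_series_incr_1. rewrite Ha0.
    rewrite <- (Cplus_0_r (bessel_red q n + _)) in Ha. exact Ha. }
  assert (Hs' : is_series (fun k => a (S k)) (q * q * bessel_red q (S (S n)))).
  { eapply is_series_ext; [exact HaS|].
    apply (is_series_scal (V := C_NormedModule)), is_series_bessel_red. }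
  apply CSeries_unique in Hs, Hs'. rewrite Hs in Hs'.
  rewrite <- Hs'. ring.
Qed.

(** Legendre's duplication formula; it produces the (2k)! of the exponential series. *)
Lemma fact_half_gamma (k : nat) :
  (INR (fact k) * half_gamma k = sqrt PI * INR (fact (2 * k)) / 4 ^ k)%R.
Proof.
  induction k as [|k IH].
  - simpl. field.
  - replace (2 * S k)%nat with (S (S (2 * k))) by lia.
    rewrite !fact_simpl, !mult_INR. cbn [half_gamma pow].
    transitivity (INR (S k) * (INR k + 1 / 2) * (INR (fact k) * half_gamma k))%R. ring.
    rewrite IH, !S_INR, mult_INR. simpl (INR 2). field. apply pow_nonzero. lra.
Qed.

(* Up to a power of [q] the left side is [I_(-1/2)(2q) - I_(1/2)(2q)]; its two series are the
   even and odd parts of the exponential series. *)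
Lemma bessel_red_0_1 (q : C) :
  bessel_red q 0 - q * bessel_red q 1 = Cexp (- (2 * q)) * RtoC (/ sqrt PI).
Proof.
  pose (a k := bessel_term q 0 k + - q * bessel_term q 1 k).
  assert (Hpi : (0 < sqrt PI)%R) by apply sqrt_lt_R0, PI_RGT_0.
  assert (Ha : is_series a (bessel_red q 0 + - q * bessel_red q 1)).
  { apply (is_series_plus (V := C_NormedModule)). apply is_series_bessel_red.
    apply (is_series_scal (V := C_NormedModule)), is_series_bessel_red. }
  pose (e j := RtoC (/ sqrt PI) * ((- (2 * q)) ^ j / RtoC (INR (fact j)))).
  assert (He : is_series e (RtoC (/ sqrt PI) * Cexp (- (2 * q)))).
  { apply (is_series_scal (V := C_NormedModule)), is_series_Cexp. }
  assert (Hterm : forall k, a k = e (2 * k)%nat + e (S (2 * k))).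
  { intros k. unfold a, e. rewrite !bessel_term_eq, Cpow_S.
    replace (- (2 * q)) with (RtoC (Ropp 2) * q) by (rewrite RtoC_opp; ring).
    rewrite !Cpow_mult_l, <- RtoC_pow. unfold Cdiv.
    rewrite <- !RtoC_inv by apply INR_fact_neq_0.
    rewrite pow_mult. replace ((Ropp 2) ^ 2)%R with 4%R by ring.
    replace (INR (fact k) * half_gamma (1 + k))%R with ((INR k + 1 / 2) * (INR (fact k) * half_gamma k))%R
      by (cbn [half_gamma Nat.add]; ring).
    rewrite Nat.add_0_l, fact_half_gamma.
    replace (/ (sqrt PI * INR (fact (2 * k)) / 4 ^ k))%R with (/ sqrt PI * (4 ^ k * / INR (fact (2 * k))))%R.
    2:{ field. repeat split; try apply INR_fact_neq_0; try lra; apply pow_nonzero; lra. }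
    replace (/ ((INR k + 1 / 2) * (sqrt PI * INR (fact (2 * k)) / 4 ^ k)))%R
      with (/ sqrt PI * (4 ^ k * (2 * / INR (fact (S (2 * k))))))%R.
    2:{ rewrite fact_simpl, mult_INR, S_INR, mult_INR. simpl (INR 2).
        pose proof (pos_INR k). field. repeat split; try apply INR_fact_neq_0; try lra; apply pow_nonzero; lra. }
    rewrite !RtoC_mult, RtoC_opp. ring. }
  (* The pairs 0 to n use up 2n + 2 exponential terms, the last of index 2n + 1. This subsequence of
     partial sums suffices, since the exponential series is known to converge. *)
  assert (Hsum : forall n, sum_n e (S (2 * n)) = sum_n a n).
  { induction n as [|n IH].
    - change (S (2 * 0)) with 1%nat. rewrite sum_Sn, !sum_O. symmetry. exact (Hterm 0%nat).
    - replace (S (2 * S n)) with (S (S (S (2 * n)))) by lia.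
      rewrite !sum_Sn, <- IH, sum_Sn, Hterm.
      replace (2 * S n)%nat with (S (S (2 * n))) by lia.
      symmetry. apply (Cplus_assoc (plus (sum_n e (2 * n)) (e (S (2 * n))))). }
  assert (Ha' : is_series a (RtoC (/ sqrt PI) * Cexp (- (2 * q)))).
  { apply (filterlim_ext (fun n => sum_n e (S (2 * n))) _ Hsum).
    eapply filterlim_comp; [|exact He].
    apply (eventually_subseq (fun n => S (2 * n))). intros n. lia. }
  apply CSeries_unique in Ha, Ha'. rewrite Ha in Ha'.
  transitivity (bessel_red q 0 + - q * bessel_red q 1). ring. rewrite Ha'. ring.
Qed.

(** * The telescoping sum *)

Lemma is_Cderive_comp (f : R -> C) (h : R -> R) (t dh : R) (l : C) :
  is_Cderive f (h t) l -> is_derive h t dh -> is_Cderive (fun s => f (h s)) t (RtoC dh * l).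
Proof.
  intros [F1 F2] H. split.
  - evar_last. exact (is_derive_comp (V := R_NormedModule) _ _ _ _ _ F1 H).
    unfold scal; simpl. unfold mult, Re, Im; simpl. ring.
  - evar_last. exact (is_derive_comp (V := R_NormedModule) _ _ _ _ _ F2 H).
    unfold scal; simpl. unfold mult, Re, Im; simpl. ring.
Qed.

Lemma is_Cderive_continuous (f : R -> C) (t : R) (l : C) : is_Cderive f t l ->
  continuous (fun s => Re (f s)) t /\ continuous (fun s => Im (f s)) t.
Proof.
  intros [H1 H2]. split; apply (ex_derive_continuous (V := R_NormedModule)); eexists; eassumption.
Qed.

Lemma is_derive_RInt_0 (g : R -> R) (c : R) : (forall t, continuous g t) ->
  is_derive (RInt g 0) c (g c).
Proof.
  intros Hg. apply (is_derive_RInt g (RInt g 0) 0 c); [|apply Hg].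
  apply filter_forall. intros b. apply (RInt_correct (V := R_CompleteNormedModule)).
  apply (ex_RInt_continuous (V := R_CompleteNormedModule)). intros z _. apply Hg.
Qed.

Lemma RInt_scale_0_1 (g : R -> R) (c : R) : (forall t, continuous g t) ->
  (c * RInt (fun s => g (c * s)%R) 0 1 = RInt g 0 c)%R.
Proof.
  intros Hg.
  assert (H1 : is_RInt g 0 c (RInt g 0 c)).
  { apply (RInt_correct (V := R_CompleteNormedModule)).
    apply (ex_RInt_continuous (V := R_CompleteNormedModule)). intros z _. apply Hg. }
  assert (H2 : is_RInt (fun s => scal c (g (c * s + 0)%R)) 0 1 (RInt g 0 c)).
  { apply (is_RInt_comp_lin (V := R_NormedModule)).
    rewrite Rmult_0_r, Rmult_1_r, !Rplus_0_r. exact H1. }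
  assert (H3 : is_RInt (fun s => scal c (g (c * s)%R)) 0 1 (scal c (RInt (fun s => g (c * s)%R) 0 1))).
  { apply (is_RInt_scal (V := R_NormedModule)).
    apply (RInt_correct (V := R_CompleteNormedModule)).
    apply (ex_RInt_continuous (V := R_CompleteNormedModule)). intros z _.
    apply (continuous_comp (fun s => c * s)%R g); [|apply Hg].
    apply (continuous_scal_r (V := R_NormedModule) c (fun s => s)). apply continuous_id. }
  apply (is_RInt_unique (V := R_CompleteNormedModule)) in H2, H3. rewrite <- H2.
  transitivity (scal c (RInt (fun s => g (c * s)%R) 0 1)); [reflexivity|].
  rewrite <- H3. apply RInt_ext. intros s _. rewrite Rplus_0_r. reflexivity.
Qed.

Lemma erf_0 : erf 0 = 0.
Proof. unfold erf, CInt. ring. Qed.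

(** Along the real line spanned by w, the segment integral is w times a primitive in the real
    parameter, so the fundamental theorem of calculus applies to each component and path
    independence is not involved. *)
Lemma is_Cderive_erf (w : C) (c : R) :
  is_Cderive (fun s => erf (w * RtoC s)) c
    (RtoC (2 / sqrt PI) * w * Cexp (- ((w * RtoC c) * (w * RtoC c)))).
Proof.
  pose (g t := Cexp (- ((w * RtoC t) * (w * RtoC t)))).
  assert (Hg : forall t, continuous (fun s => Re (g s)) t /\ continuous (fun s => Im (g s)) t).
  { intros t. eapply is_Cderive_continuous. unfold g. apply is_Cderive_Cexp.
    apply (is_Cderive_ext (fun s => (- (w * w)) * (RtoC s * RtoC s))). intros s; ring.
    apply is_Cderive_scal. apply is_Cderive_mult; apply is_Cderive_RtoC, (is_derive_id (K := R_AbsRing)). }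
  pose (K s := ((RInt (fun t => Re (g t)) 0 s, RInt (fun t => Im (g t)) 0 s) : C)).
  apply (is_Cderive_ext (fun s => (RtoC (2 / sqrt PI) * w) * K s)).
  2:{ apply is_Cderive_scal. split.
      - apply (is_derive_RInt_0 (fun t => Re (g t))). intros t. exact (proj1 (Hg t)).
      - apply (is_derive_RInt_0 (fun t => Im (g t))). intros t. exact (proj2 (Hg t)). }
  intros s. unfold erf, CInt.
  pose (J := (RInt (fun t => Re (g (s * t)%R)) 0 1, RInt (fun t => Im (g (s * t)%R)) 0 1) : C).
  transitivity (RtoC (2 / sqrt PI) * ((w * RtoC s - 0) * J)).
  - replace (K s) with (RtoC s * J).
    + ring.
    + unfold K, J. rewrite <- (RInt_scale_0_1 (fun t => Re (g t)) s (fun t => proj1 (Hg t))),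
        <- (RInt_scale_0_1 (fun t => Im (g t)) s (fun t => proj2 (Hg t))).
      apply C_eq; simpl; ring.
  - f_equal. f_equal. symmetry. apply (is_RInt_unique (V := C_R_CompleteNormedModule)).
    apply (is_RInt_ext (V := C_R_NormedModule) (fun t => g (s * t)%R)).
    { intros t _. unfold g. rewrite RtoC_mult. f_equal. Cring. }
    assert (Hc : forall h : R -> R, (forall t, continuous h t) ->
      is_RInt (fun t => h (s * t)%R) 0 1 (RInt (fun t => h (s * t)%R) 0 1)).
    { intros h Hh. apply (RInt_correct (V := R_CompleteNormedModule)).
      apply (ex_RInt_continuous (V := R_CompleteNormedModule)). intros x _.
      apply (continuous_comp (fun t => s * t)%R h); [|apply Hh].
      apply (continuous_scal_r (V := R_NormedModule) s (fun t => t)). apply continuous_id. }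
    apply is_RInt_fct_extend_pair.
    + exact (Hc (fun t => Re (g t)) (fun t => proj1 (Hg t))).
    + exact (Hc (fun t => Im (g t)) (fun t => proj2 (Hg t))).
Qed.

Definition bessel_summand (p : C) (theta : R) (m : nat) : C :=
  p * (p * p) ^ m * bessel_red (p * p) (S m) * RtoC (cos ((INR m + 1 / 2) * theta)).

(** Unlike [sum_n], this includes the empty sum, where the telescoping induction starts. *)
Fixpoint bessel_sum (p : C) (M : nat) (theta : R) : C :=
  match M with
  | O => 0
  | S m => bessel_sum p m theta + bessel_summand p theta m
  end.

(** The quantity whose successive differences are summed. At m = 0 its sines are opposite, and it
    becomes (H_0 - q H_1) sin(theta/2). *)
Definition bessel_boundary (q : C) (theta : R) (m : nat) : C :=
  q ^ m * bessel_red q m * RtoC (sin ((INR m + 1 / 2) * theta)) +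
  q ^ S m * bessel_red q (S m) * RtoC (sin ((INR m - 1 / 2) * theta)).

Lemma sum_n_bessel_summand (p : C) (theta : R) (M : nat) :
  sum_n (bessel_summand p theta) M = bessel_sum p (S M) theta.
Proof.
  induction M as [|M IH].
  - rewrite sum_O. symmetry. apply Cplus_0_l.
  - rewrite sum_Sn, IH. reflexivity.
Qed.

(* By the three-term recurrence, [2 sin(theta) S + S'] telescopes. *)
Lemma is_Cderive_bessel_sum (p : C) (M : nat) (theta : R) :
  is_Cderive (bessel_sum p M) theta
    (p * (bessel_boundary (p * p) theta M - Cexp (- (2 * (p * p))) * RtoC (sin (theta / 2) / sqrt PI))
     - 2 * (p * p) * RtoC (sin theta) * bessel_sum p M theta).
Proof.
  set (q := p * p). induction M as [|m IH].
  - apply (is_Cderive_eq _ _ 0 _ (is_Cderive_const 0 theta)).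
    replace (Cexp (- (2 * q)) * RtoC (sin (theta / 2) / sqrt PI))
      with ((bessel_red q 0 - q * bessel_red q 1) * RtoC (sin (theta / 2))).
    2:{ rewrite bessel_red_0_1. unfold Rdiv. rewrite RtoC_mult. ring. }
    unfold bessel_boundary. cbn [bessel_sum INR].
    replace ((0 + 1 / 2) * theta)%R with (theta / 2)%R by field.
    replace ((0 - 1 / 2) * theta)%R with (- (theta / 2))%R by field.
    rewrite sin_neg, RtoC_opp, Cpow_S. simpl Cpow. ring.
  - apply (is_Cderive_ext (fun s => bessel_sum p m s
       + p * q ^ m * bessel_red q (S m) * RtoC (cos ((INR m + 1 / 2) * s)))).
    { intros s. reflexivity. }
    eapply is_Cderive_eq.
    + apply is_Cderive_plus; [exact IH|]. apply is_Cderive_scal, is_Cderive_RtoC.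
      instantiate (1 := (- ((INR m + 1 / 2) * sin ((INR m + 1 / 2) * theta)))%R).
      auto_derive. exact I. ring.
    + cbn [bessel_sum]. unfold bessel_summand. fold q.
      (* The factor m + 1/2 from the derivative of the cosine is the coefficient in the recurrence,
         which trades H_(m+1) for H_m and H_(m+2). *)
      assert (Hrec : RtoC (- ((INR m + 1 / 2) * sin ((INR m + 1 / 2) * theta))) * bessel_red q (S m)
        = - (bessel_red q m - q * q * bessel_red q (S (S m))) * RtoC (sin ((INR m + 1 / 2) * theta))).
      { rewrite <- bessel_red_rec, RtoC_opp, RtoC_mult. ring. }
      (* Multiplying by 2 sin(theta) shifts the frequency up and down by one, which gives the
         H_(m+1) terms of two consecutive boundaries. *)
      assert (Htrig : 2 * RtoC (sin theta) * RtoC (cos ((INR m + 1 / 2) * theta))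
        = RtoC (sin ((INR (S m) + 1 / 2) * theta)) - RtoC (sin ((INR m - 1 / 2) * theta))).
      { rewrite S_INR.
        replace ((INR m + 1 + 1 / 2) * theta)%R with ((INR m + 1 / 2) * theta + theta)%R by field.
        replace ((INR m - 1 / 2) * theta)%R with ((INR m + 1 / 2) * theta - theta)%R by field.
        rewrite sin_plus, sin_minus, <- RtoC_minus, <- !RtoC_mult. f_equal. ring. }
      unfold bessel_boundary.
      replace (INR (S m) - 1 / 2)%R with (INR m + 1 / 2)%R by (rewrite S_INR; field).
      rewrite !Cpow_S.
      transitivity (p * (q ^ m * bessel_red q m * RtoC (sin ((INR m + 1 / 2) * theta)) +
           q * q ^ m * bessel_red q (S m) * RtoC (sin ((INR m - 1 / 2) * theta)) -
           Cexp (- (2 * q)) * RtoC (sin (theta / 2) / sqrt PI)) -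
        2 * q * RtoC (sin theta) * bessel_sum p m theta +
        p * q ^ m * (RtoC (- ((INR m + 1 / 2) * sin ((INR m + 1 / 2) * theta))) * bessel_red q (S m))).
      ring.
      rewrite Hrec.
      transitivity (p *
        (q * q ^ m * bessel_red q (S m) * RtoC (sin ((INR (S m) + 1 / 2) * theta)) +
         q * (q * q ^ m) * bessel_red q (S (S m)) * RtoC (sin ((INR m + 1 / 2) * theta)) -
         Cexp (- (2 * q)) * RtoC (sin (theta / 2) / sqrt PI)) -
        2 * q * RtoC (sin theta) * bessel_sum p m theta
        - q * p * q ^ m * bessel_red q (S m) * (2 * RtoC (sin theta) * RtoC (cos ((INR m + 1 / 2) * theta)))).
      rewrite Htrig. ring. ring.
Qed.

(** * The defect against the error function and its limit *)

Definition erf_defect (p : C) (M : nat) (theta : R) : C :=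
  2 * Cexp (- (2 * (p * p)) * RtoC (cos theta)) * bessel_sum p M theta
  - erf (2 * p * RtoC (cos (theta / 2))).

(** The exponential is the integrating factor that removes 2q sin(theta) S_M. The lower end cancels
    the derivative of erf because 2 cos(theta/2)^2 = 1 + cos(theta) splits exp(-4q cos(theta/2)^2)
    into exp(-2q cos(theta)) exp(-2q). *)
Lemma is_Cderive_erf_defect (p : C) (M : nat) (theta : R) :
  is_Cderive (erf_defect p M) theta
    (2 * p * Cexp (- (2 * (p * p)) * RtoC (cos theta)) * bessel_boundary (p * p) theta M).
Proof.
  apply (is_Cderive_ext (fun s =>
    2 * (Cexp (- (2 * (p * p)) * RtoC (cos s)) * bessel_sum p M s)
    + (- (1)) * erf (2 * p * RtoC (cos (s / 2))))).
  { intros s. unfold erf_defect. ring. }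
  eapply is_Cderive_eq.
  - apply is_Cderive_plus; apply is_Cderive_scal.
    + apply is_Cderive_mult; [|apply is_Cderive_bessel_sum].
      apply is_Cderive_Cexp, is_Cderive_scal, is_Cderive_RtoC, is_derive_cos.
    + apply (is_Cderive_comp (fun s => erf (2 * p * RtoC s)) (fun s => cos (s / 2))
        theta (- (1 / 2) * sin (theta / 2))).
      apply is_Cderive_erf. auto_derive. exact I. change (theta * / 2)%R with (theta / 2)%R. field.
  - cbv beta.
    replace (Cexp (- (2 * p * RtoC (cos (theta / 2)) * (2 * p * RtoC (cos (theta / 2))))))
      with (Cexp (- (2 * (p * p)) * RtoC (cos theta)) * Cexp (- (2 * (p * p)))).
    + replace (2 / sqrt PI)%R with (2 * / sqrt PI)%R by reflexivity.
      unfold Rdiv. rewrite !RtoC_mult, !RtoC_opp. rewrite !RtoC_mult.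
      rewrite (RtoC_inv 2) by lra. field.
    + rewrite <- Cexp_add. f_equal.
      replace (cos theta) with (2 * cos (theta / 2) * cos (theta / 2) - 1)%R.
      * rewrite RtoC_minus, !RtoC_mult. ring.
      * rewrite <- cos_2a_cos. f_equal. field.
Qed.

Lemma cos_half_integer_PI (n : nat) : cos ((INR n + 1 / 2) * PI) = 0%R.
Proof.
  apply cos_eq_0_1. exists (Z.of_nat n). rewrite <- INR_IZR_INZ. field.
Qed.

(** At pi every cosine of a half-integer multiple vanishes, and so does the argument of erf; this
    makes pi a base point independent of [M]. *)
Lemma erf_defect_PI (p : C) (M : nat) : erf_defect p M PI = 0.
Proof.
  assert (H : bessel_sum p M PI = 0).
  { induction M as [|m IH]; [reflexivity|]. cbn [bessel_sum].
    unfold bessel_summand. rewrite IH, cos_half_integer_PI. ring. }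
  unfold erf_defect. rewrite H, cos_PI2, Cmult_0_r, Cmult_0_r, erf_0. ring.
Qed.

Lemma Cmod_bessel_boundary (q : C) (theta : R) (m : nat) :
  (Cmod (bessel_boundary q theta m) <=
    Cmod q ^ m * Cmod (bessel_red q m) + Cmod q ^ S m * Cmod (bessel_red q (S m)))%R.
Proof.
  assert (H : forall n x, (Cmod (q ^ n * bessel_red q n * RtoC (sin x)) <= Cmod q ^ n * Cmod (bessel_red q n))%R).
  { intros n x. rewrite !Cmod_mult, Cmod_pow, Cmod_R.
    rewrite <- (Rmult_1_r (Cmod q ^ n * Cmod (bessel_red q n))) at 2.
    apply Rmult_le_compat_l.
    - apply Rmult_le_pos; [apply pow_le|]; apply Cmod_ge_0.
    - apply Rabs_le, SIN_bound. }
  eapply Rle_trans; [apply Cmod_triangle|]. apply Rplus_le_compat; apply H.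
Qed.

Lemma Cmod_Cexp_cos (a : C) (t : R) : (Cmod (Cexp (a * RtoC (cos t))) <= exp (Cmod a))%R.
Proof.
  eapply Rle_trans; [apply Cmod_Cexp_le|]. rewrite Cmod_mult, Cmod_R.
  assert (H : (Cmod a * Rabs (cos t) <= Cmod a)%R).
  { rewrite <- (Rmult_1_r (Cmod a)) at 2. apply Rmult_le_compat_l; [apply Cmod_ge_0|].
    apply Rabs_le, COS_bound. }
  destruct H as [H|H]; [left; apply exp_increasing, H|rewrite H; lra].
Qed.

Lemma is_series_bessel_summand (p : C) (theta : R) :
  is_series (bessel_summand p theta)
    (/ 2 * Cexp (2 * (p * p) * RtoC (cos theta)) * erf (2 * p * RtoC (cos (theta / 2)))).
Proof.
  set (q := p * p).
  pose (K := (exp (Cmod (- (2 * q))))%R).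
  pose (K' := (exp (Cmod (2 * q)))%R).
  pose (h n := (Cmod q ^ n * Cmod (bessel_red q n))%R).
  (* [sum_n] up to n has n + 1 terms, hence [M = S n] and the boundary sizes [h (S n)] and
     [h (S (S n))]. [K] bounds the integrating factor and [K'] its inverse, uniformly in theta. *)
  apply (is_series_C_bound _ _
    (fun n => (Cmod (/ 2) * K' * (2 * (Cmod (2 * p) * K) * Rabs (theta - PI))) * (h (S n) + h (S (S n))))%R).
  - intros n. rewrite sum_n_bessel_summand.
    assert (E : bessel_sum p (S n) theta - / 2 * Cexp (2 * q * RtoC (cos theta)) * erf (2 * p * RtoC (cos (theta / 2)))
      = / 2 * Cexp (2 * q * RtoC (cos theta)) * (erf_defect p (S n) theta - erf_defect p (S n) PI)).
    { rewrite erf_defect_PI. unfold erf_defect. fold q.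
      pose proof (Cexp_opp (2 * q * RtoC (cos theta))) as Ee.
      replace (- (2 * q * RtoC (cos theta))) with (- (2 * q) * RtoC (cos theta)) in Ee by ring.
      transitivity (/ 2 * 2 * (Cexp (- (2 * q) * RtoC (cos theta)) * Cexp (2 * q * RtoC (cos theta))) * bessel_sum p (S n) theta
        - / 2 * Cexp (2 * q * RtoC (cos theta)) * erf (2 * p * RtoC (cos (theta / 2)))).
      - rewrite Ee. field.
      - ring. }
    replace (bessel_sum p (S n) theta - _) with
      (/ 2 * Cexp (2 * q * RtoC (cos theta)) * (erf_defect p (S n) theta - erf_defect p (S n) PI)) by (symmetry; exact E).
    rewrite Cmod_mult, (Cmod_mult (/ 2)).
    replace (Cmod (/ 2) * K' * (2 * (Cmod (2 * p) * K) * Rabs (theta - PI)) * (h (S n) + h (S (S n))))%R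
      with ((Cmod (/ 2) * K') * (2 * (Cmod (2 * p) * K * (h (S n) + h (S (S n)))) * Rabs (theta - PI)))%R by ring.
    apply Rmult_le_compat.
    + apply Rmult_le_pos; apply Cmod_ge_0.
    + apply Cmod_ge_0.
    + apply Rmult_le_compat_l; [apply Cmod_ge_0|apply Cmod_Cexp_cos].
    + eapply Cmean_value. intros t _. split; [apply is_Cderive_erf_defect|].
      cbv beta. rewrite (Cmod_mult (2 * p * _)), (Cmod_mult (2 * p)).
      apply Rmult_le_compat.
      * apply Rmult_le_pos; apply Cmod_ge_0.
      * apply Cmod_ge_0.
      * apply Rmult_le_compat_l; [apply Cmod_ge_0|apply Cmod_Cexp_cos].
      * apply Cmod_bessel_boundary.
  - evar_last.
    + apply is_lim_seq_scal_l, (is_lim_seq_plus' _ _ 0 0);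
        [|apply (is_lim_seq_incr_1 (fun n => h (S n)))];
        apply (is_lim_seq_incr_1 h), pow_bessel_red_lim.
    + simpl. f_equal. ring.
Qed.

(** For order m + 1/2 the Gamma argument is m + k + 3/2, that is (m + 1) + k + 1/2; this is the
    origin of the index [S m]. *)
Lemma BesselI_half_integer (z : C) (m : nat) : z <> 0 ->
  let p := Csqrt z / 2 in
  BesselI (INR m + 1 / 2) (z / 2) = p * (p * p) ^ m * bessel_red (p * p) (S m).
Proof.
  intros Hz p.
  assert (Hp : p * p = RtoC (/ 4) * z).
  { unfold p. rewrite <- (Csqrt_sqr z Hz) at 3. rewrite RtoC_inv by lra.
    replace (RtoC 4) with (2 * 2) by (rewrite <- RtoC_mult; f_equal; ring).
    field. }
  assert (Hx : z / 2 / 2 = p * p).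
  { rewrite Hp, RtoC_inv by lra.
    replace (RtoC 4) with (2 * 2) by (rewrite <- RtoC_mult; f_equal; ring).
    field. }
  unfold BesselI. rewrite Hx.
  rewrite Cpower_half_integer.
  (* Only the argument of [Csqrt] is written as z/4; this selects the root p and not -p. *)
  - rewrite Hp at 1. rewrite Csqrt_div_4 by exact Hz. fold p.
    f_equal. unfold bessel_red, CSeries. f_equal; apply Series_ext; intros k; unfold bessel_term;
    rewrite (Gamma_half (m + k)); try reflexivity; rewrite plus_INR; field.
  - rewrite Hp. apply Cmult_neq_0; [|exact Hz]. intros E; apply RtoC_inj in E; lra.
Qed.

Theorem mainTheorem8 (z w : C) (theta : R)
    (hz : ~ (Im z = 0%R /\ (Re z <= 0)%R))
    (hw : w = Csqrt (- (2) * Ci * z)) :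
  let u := fun m : nat =>
    BesselI (INR m + 1 / 2) (w ^ 2 / 2) *
    RtoC (cos ((INR m + 1 / 2) * theta)) in
  ex_series u /\
  erf (w * RtoC (cos (theta / 2))) =
    2 * Cexp (- (1 / 2) * w ^ 2 * RtoC (cos theta)) * CSeries u.
Proof.
  intros u.
  assert (H2 : RtoC 2 <> 0) by (intros E; apply RtoC_inj in E; lra).
  (* The origin lies on the excluded half-line, so the radicand has a genuine logarithm. *)
  assert (Hz : - (2) * Ci * z <> 0).
  { apply Cmult_neq_0; [apply Cmult_neq_0|].
    - intros E. apply (f_equal Copp) in E. rewrite Copp_0 in E. apply H2. rewrite <- E. ring.
    - apply Ci_nz.
    - intros ->. apply hz. simpl. split; [reflexivity|lra]. }
  set (x := - (2) * Ci * z) in *.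
  assert (Hw2 : w ^ 2 = x).
  { rewrite hw, !Cpow_S. simpl Cpow. rewrite Cmult_1_r. apply Csqrt_sqr, Hz. }
  set (p := w / 2).
  assert (Hp : w = 2 * p) by (unfold p; field).
  assert (Hu : forall m, bessel_summand p theta m = u m).
  { intros m. unfold u, bessel_summand. rewrite Hw2, BesselI_half_integer by exact Hz.
    unfold p. rewrite hw. reflexivity. }
  assert (Hs : is_series u (/ 2 * Cexp (2 * (p * p) * RtoC (cos theta)) * erf (w * RtoC (cos (theta / 2))))).
  { apply (is_series_ext _ _ _ Hu). rewrite Hp. apply is_series_bessel_summand. }
  split.
  - eexists. exact Hs.
  - rewrite (CSeries_unique _ _ Hs).
    replace (- (1 / 2) * w ^ 2 * RtoC (cos theta)) with (- (2 * (p * p) * RtoC (cos theta))).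
    2:{ rewrite Hp, !Cpow_S. simpl Cpow. field. }
    pose proof (Cexp_opp (2 * (p * p) * RtoC (cos theta))) as Ee.
    transitivity ((2 * / 2) * (Cexp (- (2 * (p * p) * RtoC (cos theta))) * Cexp (2 * (p * p) * RtoC (cos theta)))
       * erf (w * RtoC (cos (theta / 2)))).
    + rewrite Ee. field.
    + ring.
Qed.
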